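(* Let $K=\mathbb{F}_q$ be a finite field, let $s\geq 2$, let $A_1,\ldots,A_{s-1}$ be subsets of $\mathbb{F}_q$ with $d_i=|A_i|$ for $i=1,\ldots,s-1$, and let $$\mathbb{X}:=[A_1\times\cdots\times A_{s-1}\times\{1\}]=\{[(a_1,\ldots,a_{s-1},1)] : a_i\in A_i \text{ for all } i\}\subset\mathbb{P}^{s-1}.$$ Assume $2\leq d_1\leq\cdots\leq d_{s-1}$ and let $d\geq 1$ be an integer. Suppose $d=\sum_{i=1}^{k}(d_i-1)+\ell$, where $k,\ell$ are integers with $0\leq k\leq s-2$ and $1\leq\ell\leq d_{k+1}-1$ (such $k,\ell$ are unique when they exist). Then, for every integer $r$ with $1\leq r\leq s-k-1$, the $r$-th generalized Hamming weight of the Reed--Muller-type code $C_{\mathbb{X}}(d)$ is $$\delta_r(C_{\mathbb{X}}(d))=\begin{cases} d_{k+r+1}\cdots d_{s-1}\left[(d_{k+1}-\ell+1)\,d_{k+2}\cdots d_{k+r}-1\right] & \text{if } 1\leq r<s-k-1,\\[2mm] (d_{k+1}-\ell+1)\,d_{k+2}\cdots d_{s-1}-1 & \text{if } 1\leq r=s-k-1,\end{cases}$$ where one sets $d_i\cdots d_j=1$ if $i>j$ or $i<1$.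
   Context: Let $K=\mathbb{F}_q$ and let $\mathbb{P}^{s-1}$ be the projective space over $K$ (points $[x]$, $x\in K^s\setminus\{0\}$, modulo scaling by $K^*$). A linear code of length $m$ is a $K$-linear subspace $C\subset K^m$. The support of a subspace $D\subset C$ is $\chi(D)=\{i : \exists (a_1,\ldots,a_m)\in D,\ a_i\neq 0\}$. For $1\leq r\leq\dim_K C$, the $r$-th generalized Hamming weight $\delta_r(C)$ is the minimum of $|\chi(D)|$ over all $r$-dimensional subspaces $D\subset C$. Let $S=K[t_1,\ldots,t_s]$ with the standard grading, $S_d$ its homogeneous part of degree $d$. For a nonempty set $\mathbb{X}=\{[P_1],\ldots,[P_m]\}\subset\mathbb{P}^{s-1}$ with $m=|\mathbb{X}|$, $P_i\in K^s$, and $d\geq 1$, choose $h_i\in S_d$ with $h_i(P_i)\neq 0$ for each $i$. The Reed--Muller-type code is $$C_{\mathbb{X}}(d)=\left\{\left(\tfrac{h(P_1)}{h_1(P_1)},\ldots,\tfrac{h(P_m)}{h_m(P_m)}\right) : h\in S_d\right\}\subset K^m.$$ Its length, dimension, and generalized Hamming weights do not depend on the choices of the representatives $P_i$ and of the $h_i$. *)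

(* Defs.v *)
From HB Require Import structures.
From mathcomp Require Import all_boot all_order all_algebra.
From mathcomp Require Import mpoly.

Set Implicit Arguments.
Unset Strict Implicit.
Unset Printing Implicit Defensive.

Import GRing.Theory.

Local Open Scope ring_scope.

Section FiniteVspace.
Import VectorInternalTheory.
HB.instance Definition _ (K : finFieldType) (vT : vectType K) :=
  [Finite of {vspace vT} by <:].
End FiniteVspace.

Section Codes.

Variables (K : finFieldType) (m : nat).

Implicit Types C D : {vspace 'rV[K]_m}.

Definition code_support D : {set 'I_m} :=
  [set i | [exists a : 'rV[K]_m, (a \in D) && (a 0 i != 0)]].

(* The default value m of the iterated minimum is harmless: every support has
   at most m elements, so this is the minimum whenever r <= \dim C. *)
Definition ghw (r : nat) C : nat :=
  \big[minn/m]_(D : {vspace 'rV[K]_m} | (D <= C)%VS && (\dim D == r))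
     #|code_support D|.

Lemma ghw_le r C D :
  (D <= C)%VS -> \dim D = r -> (ghw r C <= #|code_support D|)%N.
Proof.
move=> sDC /eqP dD; rewrite /ghw; have := mem_index_enum D.
elim: (index_enum _) => // E s IH; rewrite inE big_cons => /predU1P[<-|/IH le_s].
  by rewrite sDC dD geq_minl.
by case: ifP => // _; rewrite geq_min le_s orbT.
Qed.

Lemma ghw_attained r C : (r <= \dim C)%N ->
  exists D, [/\ (D <= C)%VS, \dim D = r & #|code_support D| = ghw r C].
Proof.
move=> le_r; pose D0 := <<take r (vbasis C)>>%VS.
have bC := vbasisP C.
have D0C : (D0 <= C)%VS.
  by apply/span_subvP => v /mem_take vC; exact: vbasis_mem.
have dD0 : \dim D0 == r.
  have: free (take r (vbasis C)).
    by have := basis_free bC; rewrite -{1}(cat_take_drop r (vbasis C)) => /catl_free.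
  by rewrite /free /D0 => /eqP ->; rewrite size_take_min size_tuple (minn_idPl le_r).
have [D /andP[sDC /eqP dD] minD] :=
  @arg_minnP _ D0 (fun D => (D <= C)%VS && (\dim D == r))
    (fun D => #|code_support D|) (introT andP (conj D0C dD0)).
exists D; split=> //; apply/eqP; rewrite eqn_leq ghw_le // andbT.
rewrite /ghw; apply: (big_ind (fun x => #|code_support D| <= x)%N) => //.
- by rewrite -[leqRHS](card_ord m) max_card.
- by move=> x y hx hy; rewrite leq_min hx hy.
Qed.

End Codes.

Section ReedMuller.

Variables (K : finFieldType) (n : nat).

(* The point [x] of P^n, encoded as the set of nonzero multiples of x. *)
Definition ppoint (x : 'rV[K]_n.+1) : {set 'rV[K]_n.+1} :=
  [set c *: x | c : K & c != 0].

Definition pspace : {set {set 'rV[K]_n.+1}} := [set ppoint x | x in predC1 0].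

(* The sets are numbered from 1: only A 1, ..., A n matter. *)
Definition pcartesian (A : nat -> {set K}) : {set {set 'rV[K]_n.+1}} :=
  [set ppoint x | x : 'rV[K]_n.+1 &
     [forall i : 'I_n, x 0 (lift ord_max i) \in A i.+1] && (x 0 ord_max == 1)].

Lemma ppoint_eqP (x y : 'rV[K]_n.+1) :
  reflect (exists2 c : K, c != 0 & y = c *: x) (ppoint x == ppoint y).
Proof.
apply: (iffP eqP) => [exy | [c c0 ->]].
  have : y \in ppoint x.
    by rewrite exy; apply/imsetP; exists 1; rewrite ?scale1r // inE oner_eq0.
  by case/imsetP => c; rewrite inE; exists c.
apply/setP => z; apply/imsetP/imsetP => -[b]; rewrite inE => b0 ->.
  by exists (b / c); rewrite ?inE ?mulf_neq0 ?invr_eq0 // scalerA divfK.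
by exists (b * c); rewrite ?inE ?mulf_neq0 // scalerA.
Qed.

Lemma pcartesian_sub A : pcartesian A \subset pspace.
Proof.
apply/subsetP => p /imsetP[x]; rewrite inE => /andP[_ x1] ->.
apply: imset_f; rewrite inE; apply: contraTneq x1 => ->.
by rewrite mxE eq_sym oner_eq0.
Qed.

Variables (m d : nat).
Variables (P : 'I_m -> 'rV[K]_n.+1) (h_ : 'I_m -> dhomog n.+1 K d).

Definition rm_eval (h : dhomog n.+1 K d) : 'rV[K]_m :=
  \row_i (h.@[P i 0] / (h_ i).@[P i 0]).

Lemma rm_eval_is_linear : linear rm_eval.
Proof.
by move=> c f g; apply/rowP => i; rewrite !mxE /= mevalD mevalZ mulrDl mulrA.
Qed.

HB.instance Definition _ :=
  GRing.isLinear.Build K (dhomog n.+1 K d) 'rV[K]_m _ rm_eval rm_eval_is_linear.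

Definition rm_code : {vspace 'rV[K]_m} := limg (linfun rm_eval).

Lemma rm_codeP (v : 'rV[K]_m) :
  reflect (exists h, v = rm_eval h) (v \in rm_code).
Proof.
apply: (iffP memv_imgP) => [[h _ ->]|[h ->]]; exists h => //.
- by rewrite lfunE.
- exact: memvf.
- by rewrite lfunE.
Qed.

End ReedMuller.

(* Main.v *)
Require Import Defs.
From mathcomp Require Import all_boot all_order all_algebra.
From mathcomp Require Import mpoly.
From mathcomp Require Import zify.

(** The footprint bound turns the lower bound into combinatorics.  Dehomogenize
    by adding x_max - 1 to the equations of the grid.  A subspace D of dimension
    r of the code yields r distinct leading monomials of degree at most d inside
    the box of sides d_1, ..., d_n, and the zeros common to D are at most as
    many as the monomials of the box divisible by none of these.  So the support
    of D is at least as large as an up-set of the box that is generated by r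
    elements of degree at most d.

    The smallest such up-sets are found by induction on the number of variables,
    slicing along the variable with the smallest side.  Shifting an up-set along
    that variable keeps the sides sorted and does not change the bound, so one
    may assume that some generator lies in the bottom slice; what is left
    depends on whether no, one or more generators lie outside that slice.

    The bound is attained by the r products of one polynomial of degree d - 1,
    namely prod_(i <= k) prod_(a in A_i, a <> c_i) (x_i - a) times l - 1 linear
    factors in x_(k+1), with x_(k+1) - c_(k+1), ..., x_(k+r) - c_(k+r). *)

Set Implicit Arguments.
Unset Strict Implicit.
Unset Printing Implicit Defensive.

Import Order.TTheory GRing.Theory.

(** * Up-sets of monomials in a box *)

Definition prodseq (s : seq nat) := foldr muln 1 s.

(* The value 0 for j > size s is what makes the bound [wt] hold for every
   positive number of generators. *)
Fixpoint tailprod (s : seq nat) j :=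
  if j is j'.+1 then if s is _ :: s' then tailprod s' j' else 0
  else prodseq s.

(* If d = \sum_(i <= k) (d_i - 1) + l with 1 <= l < d_(k+1), then
   wt [:: d_1; ...; d_n] d r =
     (d_(k+1) - l + 1) d_(k+2) ... d_n - d_(k+r+1) ... d_n. *)
Fixpoint wt_main (s : seq nat) d :=
  if s is c :: s' then
    if d < c then (c.+1 - d) * prodseq s' else wt_main s' (d - c.-1)
  else 1.

Fixpoint wt_corr (s : seq nat) d r :=
  if s is c :: s' then
    if d < c then tailprod s' r.-1 else wt_corr s' (d - c.-1) r
  else 0.

Definition wt (s : seq nat) d r := wt_main s d - wt_corr s d r.

(** * Arithmetic of the bound *)

Lemma tailprod0 s : tailprod s 0 = prodseq s.
Proof. by case: s. Qed.

Lemma prodseq_gt0 s : all (leq 1) s -> 0 < prodseq s.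
Proof. by elim: s => //= c s IH /andP[c0 /IH s0]; rewrite muln_gt0 c0. Qed.

Lemma tailprodS c s j : all (leq c) s -> c * tailprod s j.+1 <= tailprod s j.
Proof.
elim: s j => [|a s IH] [|j] //=; rewrite ?muln0 //.
- by move=> /andP[ca _]; rewrite tailprod0 leq_mul2r ca orbT.
- by case/andP=> _ /IH.
Qed.

Lemma tailprod_homo s i j :
  all (leq 1) s -> i <= j -> tailprod s j <= tailprod s i.
Proof.
move=> s1 /subnKC <-; elim: (j - i) => [|q IH]; first by rewrite addn0.
by apply: leq_trans IH; rewrite addnS; have := tailprodS (i + q) s1; rewrite mul1n.
Qed.

Lemma tailprod_le s j : all (leq 1) s -> tailprod s j <= prodseq s.
Proof. by move=> s1; rewrite -tailprod0 tailprod_homo. Qed.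

Lemma wt_main1 s : all (leq 1) s -> wt_main s 1 = prodseq s.
Proof.
elim: s => //= c s IH /andP[c0 s1]; case: ltnP => [c1|c1].
  by rewrite subSS subn0.
by (have -> : c = 1 by lia); rewrite IH // mul1n.
Qed.

Lemma wt_corr_le_prod s d r : all (leq 1) s -> wt_corr s d r <= prodseq s.
Proof.
elim: s d => //= c s IH d /andP[c0 s1]; case: ifP => _.
  by apply: leq_trans (tailprod_le _ s1) _; rewrite leq_pmull.
by apply: leq_trans (IH _ s1) _; rewrite leq_pmull.
Qed.

Lemma wt_corr_le s d r : all (leq 1) s -> wt_corr s d r <= wt_main s d.
Proof.
elim: s d => //= c s IH d /andP[c0 s1]; case: (ltnP d c) => [dc|_]; last exact: IH.
by apply: leq_trans (tailprod_le _ s1) _; rewrite leq_pmull //; lia.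
Qed.

Lemma wt_corr_homo s d i j :
  all (leq 1) s -> i <= j -> wt_corr s d j <= wt_corr s d i.
Proof.
move=> s1 ij; elim: s d s1 => //= c s IH d /andP[_ s1]; case: ifP => _.
  by apply: tailprod_homo => //; lia.
exact: IH.
Qed.

(* The main term is the minimum distance in degree [d - 1]. *)
Lemma wt_r1 s d : all (leq 1) s -> 0 < d -> wt s d 1 = wt_main s d.+1.
Proof.
rewrite /wt; elim: s d => //= c s IH d /andP[c0 s1] d0.
have [dc|dc] := ltnP d c.
  rewrite tailprod0; case: ltnP => [dc'|dc'].
    by rewrite !subSS (subSn (ltnW dc)) mulSn addKn.
  have -> : c = d.+1 by lia.
  by rewrite [d.+1 - _]subSnn wt_main1 // subSn // subSnn mulSn mul1n addnK.
by rewrite ltnNge (leq_trans dc) //= IH // ?subSn //; lia.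
Qed.

(** Inside a block, each unit of degree costs the main term the product of the remaining sides,
    which is at least the correction. *)
Lemma wt_main_drop s d q j :
  all (leq 1) s -> 0 < d ->
  wt_main s (d + q) + q * wt_corr s (d + q) j <= wt_main s d.
Proof.
elim: s d q => [|c s IH] d q /=; first by rewrite muln0 addn0.
case/andP=> c0 s1 d0; have Rle := tailprod_le j.-1 s1.
have [h1|h1] := ltnP (d + q) c.
  by (have -> : d < c by lia); nia.
have [h2|h2] := ltnP d c.
  (* The degree leaves the first block: c - d units are spent inside it and d + q - c units after
     it, starting from degree 1, where the main term is the full product. *)
  have e : d + q - c.-1 = 1 + (d + q - c) by lia.
  have := IH 1 (d + q - c) s1 isT; rewrite -e (wt_main1 s1).
  by have := @wt_corr_le_prod s (d + q - c.-1) j s1; nia.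
by rewrite -addnBAC; [apply: IH => //|]; lia.
Qed.

(* In this section s stands for c :: s' with t = c - 1, so that
   wt (c :: s') (e + t) r = wt s' e r compares a box with its slices. *)
Section Shift.
Variable t : nat.

(** For the case where all generators lie in the bottom slice: the t + 1 slices then all satisfy the
    same bound. *)
Lemma wt_shift s e r :
  sorted leq s -> all (ltn t) s -> 0 < e -> wt s e r <= t.+1 * wt s (e + t) r.
Proof.
elim: s e => // c s IH e cs /= /andP[tc ts] e0.
have s1 : all (leq 1) s by apply: sub_all ts => x /=; lia.
have Rle := tailprod_le r.-1 s1.
rewrite /wt /=; have [h1|h1] := ltnP (e + t) c.
  by (have -> : e < c by lia); nia.
have [h2|h2] := ltnP e c; last first.
  by rewrite -addnBAC; [apply: IH => //; [exact: path_sorted cs|]|]; lia.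
case: s {IH} cs ts s1 Rle => [|b s] /=; first by move=> _ _ _ _; nia.
case/andP=> cb _ /andP[tb ts] /andP[b0 s1] Rle.
(* As e < c and t < b, raising the degree by t crosses only one block boundary. *)
have h3 : e + t - c.-1 < b by lia.
rewrite h3; have Rle' := tailprod_le r.-1 s1.
have RR : t.+1 * tailprod s r.-1 <= tailprod (b :: s) r.-1.
  by apply: (@tailprodS t.+1 (b :: s)); rewrite /= tb.
(* With x = c + 1 - e, the right side minus the left is (b - t - 1) * (t + 1 - x), and x <= t + 1
   because e + t >= c. *)
have k : (c.+1 - e) * b <= t.+1 * (b.+1 - (e + t - c.-1)).
  by (have -> : b.+1 - (e + t - c.-1) = (b - t.+1) + (c.+1 - e) by lia); nia.
by rewrite mulnBr !mulnA leq_sub // leq_mul2r k orbT.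
Qed.

(** For the case of several generators outside the bottom slice. A main term contains its last
    product of sides at least twice and the correction removes at most one copy; the copy left
    dominates the correction in degree e. *)
Lemma wt_ge_corr s e r :
  sorted leq s -> all (ltn t) s -> 0 < e -> wt_corr s e 2 <= wt s (e + t) r.
Proof.
elim: s e => // c s IH e cs /= /andP[tc ts] e0.
have s1 : all (leq 1) s by apply: sub_all ts => x /=; lia.
have Rle := tailprod_le r.-1 s1; have Rle1 := tailprod_le 1 s1.
rewrite /wt /=; have [h1|h1] := ltnP (e + t) c.
  by (have -> : e < c by lia); nia.
have [h2|h2] := ltnP e c; last first.
  by rewrite -addnBAC; [apply: IH => //; [exact: path_sorted cs|]|]; lia.
case: s {IH Rle Rle1} cs ts s1 => [|b s] //=.
case/andP=> cb _ /andP[tb ts] /andP[b0 s1].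
have h3 : e + t - c.-1 < b by lia.
by rewrite h3 tailprod0; have := tailprod_le r.-1 s1; nia.
Qed.

(** For the case of exactly one generator outside the bottom slice, with r generators inside it. *)
Lemma wt_shift_main s e r :
  sorted leq s -> all (ltn t) s -> 0 < e -> 0 < t -> 0 < r ->
  wt s e r.+1 <= t.+1 * wt_main s (e + t) - wt_corr s (e + t) r.
Proof.
move=> + + + t0 r0; elim: s e => [|c s IH] e cs /=; first by rewrite /wt /=; lia.
move=> /andP[tc ts] e0.
have s1 : all (leq 1) s by apply: sub_all ts => x /=; lia.
have Rle := tailprod_le r.-1 s1.
rewrite /wt /=; have [h1|h1] := ltnP (e + t) c.
  have -> : e < c by lia.
  have k : (c.+1 - e).+1 <= t.+1 * (c.+1 - (e + t)).
    by (have -> : c.+1 - e = c.+1 - (e + t) + t by lia); nia.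
  by have := leq_mul k (leqnn (prodseq s)); rewrite mulSn -mulnA; lia.
have [h2|h2] := ltnP e c; last first.
  by rewrite -addnBAC; [apply: IH => //; [exact: path_sorted cs|]|]; lia.
case: s {IH Rle} cs ts s1 => [|b s] /=; first by lia.
case/andP=> cb _ /andP[tb ts] /andP[b0 s1].
have h3 : e + t - c.-1 < b by lia.
(* Past the boundary, the correction for r generators equals the one for r + 1 generators before it,
   so only the main terms are compared. *)
rewrite h3; case: r r0 => // r _ /=.
have k : (c.+1 - e) * b <= t.+1 * (b.+1 - (e + t - c.-1)).
  by (have -> : b.+1 - (e + t - c.-1) = (b - t.+1) + (c.+1 - e) by lia); nia.
by rewrite !mulnA leq_sub2r // leq_mul2r k orbT.
Qed.

End Shift.

(** * Counting up-sets in a box by slices *)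

Fixpoint box (s : seq nat) : seq (seq nat) :=
  if s is c :: s' then [seq i :: x | i <- iota 0 c, x <- box s'] else [:: [::]].

Definition upset (S : seq (seq nat)) x := has (fun m => all2 leq m x) S.

Lemma mem_box_cons c s i x : (i :: x \in box (c :: s)) = (i < c) && (x \in box s).
Proof.
apply/allpairsP/andP => [[[j y] /= [jc ys [-> ->]]]|[ic xs]].
  by move: jc; rewrite mem_iota.
by exists (i, x); rewrite mem_iota.
Qed.

Lemma mem_box0 c s : [::] \in box (c :: s) = false.
Proof. by apply/negP => /allpairsP[[j y] /= [_ _]]. Qed.

Lemma box_uniq s : uniq (box s).
Proof.
elim: s => //= c s IH; apply: allpairs_uniq => //; first exact: iota_uniq.
by move=> [i x] [j y] _ _ /= [-> ->].
Qed.

Lemma size_mem_box s x : x \in box s -> size x = size s.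
Proof.
elim: s x => [|c s IH] [|i x]; rewrite ?mem_box0 ?mem_box_cons ?inE //=.
by case/andP=> _ /IH ->.
Qed.

Lemma count_box_cons a c s :
  count a (box (c :: s)) =
    \sum_(0 <= i < c) count (fun x => a (i :: x)) (box s).
Proof.
rewrite count_flatten sumnE !big_map /index_iota subn0; apply: eq_bigr => i _.
by rewrite count_map.
Qed.

Lemma size_box s : size (box s) = prodseq s.
Proof. by elim: s => //= c s IH; rewrite size_allpairs size_iota IH. Qed.

Lemma all2_leq0 x y : size x = size y -> sumn x = 0 -> all2 leq x y.
Proof.
elim: x y => [|i x IH] [|j y] //= [e] h.
by rewrite IH ?andbT //; lia.
Qed.

Lemma sumn0_nseq x : sumn x = 0 -> x = nseq (size x) 0.
Proof. by elim: x => //= i x IH h; rewrite -IH; [congr cons|]; lia. Qed.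

Definition dec_head (x : seq nat) := (head 0 x).-1 :: behead x.

Definition upset_bound s := forall d S,
  0 < d -> uniq S -> 0 < size S -> {subset S <= box s} ->
  {in S, forall x, sumn x <= d} -> wt s d (size S) <= count (upset S) (box s).

(** By [wt_r1], the bound for a single generator is the main term one degree higher. Degree 0,
    excluded from [upset_bound], gives the whole box. *)
Lemma upset1_bound s e m :
  all (leq 1) s -> upset_bound s -> m \in box s -> sumn m <= e ->
  wt_main s e.+1 <= count (fun x => all2 leq m x) (box s).
Proof.
move=> s1 IH ms; case: e => [|e] me.
  rewrite wt_main1 // -size_box -(@count_predT _ (box s)); apply/eq_leq/esym.
  apply: eq_in_count => x xs; apply: all2_leq0; last by lia.
  by rewrite (size_mem_box xs) (size_mem_box ms).
rewrite -wt_r1 //; have := IH e.+1 [:: m] isT isT isT.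
rewrite (eq_count (a2 := fun x => all2 leq m x)); first apply.
- by move=> x; rewrite inE => /eqP ->.
- by move=> x; rewrite inE => /eqP ->.
- by move=> x; rewrite /upset /= orbF.
Qed.

Lemma sum_nat_ge_const (F : nat -> nat) a b v :
  (forall i, a <= i < b -> v <= F i) -> (b - a) * v <= \sum_(a <= i < b) F i.
Proof.
move=> h; rewrite -sum_nat_const_nat big_nat_cond [leqRHS]big_nat_cond.
by apply: leq_sum => i /andP[/h].
Qed.

Lemma upset_head0 (S : seq (seq nat)) :
  {in S, forall x, 0 < size x} ->
  let T := map behead [seq x <- S | head 0 x == 0] in
  (uniq S -> uniq T) /\ forall i x, upset T x -> upset S (i :: x).
Proof.
move=> Sn T; split=> [uS|i x].
  rewrite map_inj_in_uniq ?filter_uniq // => x y; rewrite !mem_filter.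
  case/andP=> /eqP x0 /Sn xn /andP[/eqP y0 /Sn yn].
  by case: x y x0 xn y0 yn => [|? ?] [|? ?] //= -> _ -> _ ->.
case/hasP=> _ /mapP[y + ->]; rewrite mem_filter => /andP[/eqP y0 yS] yx.
apply/hasP; exists y => //.
by have := Sn _ yS; case: y y0 yx {yS} => //= a y -> ->.
Qed.

(** Inner induction on the smallest side c. [T] holds the generators in the bottom slice with their
    first exponent removed, [S1] the generators outside it. *)
Lemma upset_bound_cons c s :
  path leq c s -> all (leq 1) (c :: s) -> upset_bound s -> upset_bound (c :: s).
Proof.
move=> + + IHs; elim: c => // c IHc pc c1 d S d0 uS S0 Sbox Sd.
have s1 : all (leq 1) s by case/andP: c1.
have Sn : {in S, forall x, 0 < size x}.
  by move=> x /Sbox /size_mem_box ->.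
have [uT upT] := upset_head0 Sn.
set T := map behead _ in uT upT; have {}uT := uT uS.
set S0' := filter _ _ in T upT uT; pose S1 := [seq x <- S | head 0 x != 0].
have szS : size S = size T + size S1.
  by rewrite size_map !size_filter -(count_predC (fun x => head 0 x == 0)).
have Tbox : {subset T <= box s}.
  move=> _ /mapP[x + ->]; rewrite mem_filter => /andP[_ /Sbox].
  by case: x => [|i x]; rewrite ?mem_box0 // mem_box_cons => /andP[].
have Td : {in T, forall x, sumn x <= d}.
  move=> _ /mapP[x + ->]; rewrite mem_filter => /andP[_ /Sd].
  by case: x => //= i x; lia.
have cntT : 0 < size T -> forall i,
    wt s d (size T) <= count (fun x => upset S (i :: x)) (box s).
  move=> Tn i; apply: leq_trans (IHs _ _ d0 uT Tn Tbox Td) _.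
  by apply: sub_count => x; apply: upT.
have srt : sorted leq (c.+1 :: s) by [].
have ct : all (ltn c) (c.+1 :: s).
  have := order_path_min leq_trans pc => /=; rewrite ltnSn.
  by apply: sub_all => x.
(* Degree d + c is past the first block, so there the bound for the box reduces to the bound for a
   slice in degree d. *)
have e2 : (d + c < c.+1) = false by clear - d0; lia.
(* Every slice contains the up-set generated by the bottom slice. *)
have [S10|S1n] := posnP (size S1).
  rewrite S10 addn0 in szS; rewrite szS in S0 *.
  apply: leq_trans (wt_shift _ srt ct d0) _.
  rewrite count_box_cons {1}/wt /= e2 -/(wt _ _ _) addnK.
  by apply: leq_trans (sum_nat_ge_const _) => [|i _]; [rewrite subn0 | apply: cntT].
have headS1 x : x \in S1 -> exists p m, [/\ x = p.+1 :: m, p.+1 :: m \in S,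
     p < c, m \in box s & p.+1 + sumn m <= d].
  rewrite mem_filter => /andP[x0 xS]; have := Sbox _ xS; have := Sd _ xS.
  case: x x0 xS => [|[|p] m] // _ xS xd.
  by rewrite mem_box_cons => /andP[pc' mb]; exists p, m; split.
have [x0 x0S1] : exists x, x \in S1.
  by case: (S1) S1n => // x S' _; exists x; rewrite mem_head.
have c0 : 0 < c by have [p [m [_ _ /(leq_trans _)-> //]]] := headS1 _ x0S1.
have uS1 : uniq S1 by rewrite filter_uniq.
(* Shifting away the bottom slice leaves the bound unchanged. *)
have rest : 1 < d ->
    count (fun x => upset S (0 :: x)) (box s) + wt (c.+1 :: s) d (size S1)
      <= count (upset S) (box (c.+1 :: s)).
  move=> d1; rewrite count_box_cons big_nat_recl // leq_add2l.
  have := IHc _ _ d.-1 (map dec_head S1); rewrite size_map => IHc'.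
  have -> : wt (c.+1 :: s) d (size S1) = wt (c :: s) d.-1 (size S1).
    rewrite /wt /=; have -> : (d.-1 < c) = (d < c.+1) by clear - d0; lia.
    have -> : d.-1 - c.-1 = d - c by clear - d0 c0; lia.
    by have -> : c.+1 - d.-1 = c.+2 - d by clear - d0; lia.
  apply: leq_trans (IHc' _ _ _ _ S1n _ _) _.
  - by case: (s) pc => //= b s' /andP[cb ->]; rewrite ltnW.
  - by rewrite /= c0.
  - by clear - d1; lia.
  - rewrite map_inj_in_uniq // => x y /headS1[p [m [-> _ _ _ _]]].
    by move=> /headS1[q [m' [-> _ _ _ _]]] [-> ->].
  - move=> _ /mapP[x /headS1[p [m [-> _ h1 h2 _]]] ->].
    by rewrite mem_box_cons h1.
  - by move=> _ /mapP[x /headS1[p [m [-> _ h1 h2 h3]]] ->] /=; clear - h3; lia.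
  rewrite count_box_cons; apply: leq_sum => i _; apply: sub_count => x /=.
  case/hasP=> _ /mapP[y /headS1[p [m [-> yS _ _ _]]] ->] /= h.
  by apply/hasP; exists (p.+1 :: m).
(* In degree 1 a shift would lead to the excluded degree 0; but then the only possible generator
   outside the bottom slice is the first variable. *)
have S1le : d <= 1 -> size S1 <= 1.
  move=> d1; apply: (@uniq_leq_size _ S1 [:: 1 :: nseq (size s) 0] uS1) => x.
  case/headS1=> [p [m [-> _ _ mb h]]]; rewrite inE.
  have -> : p = 0 by clear - h d1; lia.
  by rewrite {1}(@sumn0_nseq m) ?(size_mem_box mb) //; clear - h d1; lia.
have cntp p m i : p.+1 :: m \in S -> m \in box s -> p.+1 + sumn m <= d ->
    p < i -> wt_main s (d - p) <= count (fun x => upset S (i :: x)) (box s).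
  move=> pS mb pd pi; have -> : d - p = (d - p.+1).+1 by clear - pd; lia.
  apply: leq_trans (upset1_bound s1 IHs mb _) _; first by clear - pd; lia.
  by apply: sub_count => x h; apply/hasP; exists (p.+1 :: m); rewrite //= pi.
have [T0|Tn] := posnP (size T).
  rewrite T0 add0n in szS; have [d1|d1] := ltnP 1 d.
    by apply: leq_trans (rest d1); rewrite szS leq_addl.
  have d1' : d = 1 by clear - d0 d1; lia.
  have -> : size S = 1 by rewrite szS; have := S1le d1; clear - S1n; lia.
  have [p [m [_ pS pc' mb pd]]] := headS1 _ x0S1.
  have p0 : p = 0 by clear - d1 pd; lia.
  rewrite count_box_cons /wt d1' /= ltnS c0 tailprod0 subSS subn0 mulSn addKn.
  rewrite big_nat_recl //; apply: leq_trans (leq_addl _ _).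
  rewrite -[c in c * _]subn0; apply: sum_nat_ge_const => i _.
  by have := @cntp p m i.+1 pS mb pd; rewrite p0 d1' subn0 (wt_main1 s1); apply.
have cs1 := c1; have Rle := wt_corr_le d (size S1) cs1.
have [S2|S2] := ltnP 1 (size S1).
  have d1 : 1 < d by case: (ltnP 1 d) => // /S1le; clear - S2; lia.
  (* The shift accounts for the main term minus the correction for [size S1] generators; by
     [wt_ge_corr] the bottom slice makes up for that correction. *)
  apply: leq_trans (rest d1); have := cntT Tn 0.
  have := wt_ge_corr (size T) srt ct d0; have := wt_corr_homo d cs1 S2.
  rewrite [wt _ (d + c) _]/wt [wt_main _ (d + c)]/= [wt_corr _ (d + c) _]/=.
  by rewrite e2 addnK -/(wt _ _ _); rewrite {3 4}/wt; clear - Rle; lia.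
(* One generator p.+1 :: m is left: the slices from p.+1 on contain up(m), which
   is large since m has degree at most d - p.+1; this pays for the p.+1 slices below. *)
have {S2}S2 : size S1 = 1 by clear - S2 S1n; lia.
have [p [m [_ pS pc' mb pd]]] := headS1 _ x0S1.
rewrite szS S2 addn1.
apply: leq_trans (wt_shift_main srt ct d0 c0 Tn) _.
rewrite count_box_cons /= e2 addnK.
rewrite (@big_cat_nat _ _ _ p.+1) //=; last by clear - pc'; lia.
have h1 := @sum_nat_ge_const (fun i => count (fun x => upset S (i :: x)) (box s))
   0 p.+1 _ (fun i _ => cntT Tn i).
have h2 := @sum_nat_ge_const (fun i => count (fun x => upset S (i :: x)) (box s))
   p.+1 c.+1 (wt_main s (d - p)).
have {}h2 := h2 _; apply: leq_trans (leq_add h1 (h2 _)); last first.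
  by move=> i /andP[pi _]; apply: cntp pd pi.
have := @wt_main_drop s (d - p) p (size T) s1.
rewrite subnK; last by clear - pd; lia.
have := wt_corr_le d (size T) s1; rewrite subn0 subSS /wt.
move: (wt_main s d) (wt_corr s d _) (wt_main s (d - p)) => M Q N QM.
(* Each of the p + 1 lower slices gives M - Q, each of the c - p >= 1 upper ones at least M + p * Q.
   One upper surplus cancels p corrections, leaving the single Q allowed. *)
move=> /(_ _) H; have {}H : M + p * Q <= N by apply: H; clear - pd; lia.
have -> : c = p + (c - p.+1).+1 by clear - pc'; lia.
by move: (c - p.+1) => q; clear - H QM; nia.
Qed.

Theorem upset_card s d S :
  sorted leq s -> all (leq 1) s -> 0 < d -> uniq S -> 0 < size S ->
  {subset S <= box s} -> {in S, forall x, sumn x <= d} ->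
  wt s d (size S) <= count (upset S) (box s).
Proof.
move=> + +; suff: sorted leq s -> all (leq 1) s -> upset_bound s.
  by move=> h /h/[apply]; apply.
elim: s => [_ _ {}d {}S _ _ S0 Sb _|c s IH srt c1].
  case: S S0 Sb => //= x S _ Sb; rewrite /upset /= /wt /= addn0.
  by have := Sb _ (mem_head _ _); rewrite inE => /eqP ->.
by apply: upset_bound_cons => //; apply: IH; [apply: path_sorted srt|case/andP: c1].
Qed.

Local Open Scope ring_scope.

(** * The footprint bound *)

Lemma mpolyE_sub (R : nzRingType) N (f : {mpoly R[N]}) (L : seq 'X_{1..N}) :
  uniq L -> {subset msupp f <= L} -> f = \sum_(m <- L) f@_m *: 'X_[m].
Proof.
move=> uL fL; rewrite {1}[f]mpolyE.
rewrite [RHS](bigID (fun m => m \in msupp f)) /= [X in _ = _ + X]big1 ?addr0.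
  rewrite -[RHS]big_filter; apply: perm_big; apply: uniq_perm.
  - exact: msupp_uniq.
  - by rewrite filter_uniq.
  - move=> m; rewrite mem_filter.
    by case: (boolP (m \in msupp f)) => //= /fL ->.
by move=> m /memN_msupp_eq0 ->; rewrite scale0r.
Qed.

Section Footprint.

Variables (K : fieldType) (N : nat).
Implicit Types (G : seq {mpoly K[N]}) (m : 'X_{1..N}).

Definition standard G m := all (fun g => ~~ (mlead g <= m)%MM) G.

(** Division by G, recorded through values at the common zeros [p]. Well-founded induction on the
    monomial order: a nonstandard monomial is traded for smaller ones through a multiple of some g,
    and the order refines the degree, so the degree bound survives. *)
Lemma standard_reduction (I : Type) (p : I -> 'I_N -> K) G d (h : {mpoly K[N]}) :
  0 \notin G -> {in G, forall g, forall j, g.@[p j] = 0} ->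
  {in msupp h, forall m, mdeg m <= d}%N ->
  exists2 f, {in msupp f, forall m, standard G m && (mdeg m <= d)%N}
           & forall j, h.@[p j] = f.@[p j].
Proof.
move=> G0 Gp hd.
pose red (q : {mpoly K[N]}) :=
  exists2 f, {in msupp f, forall m, standard G m && (mdeg m <= d)%N}
           & forall j, q.@[p j] = f.@[p j].
have red0 : red 0 by exists 0 => // m; rewrite msupp0.
have redD q1 q2 : red q1 -> red q2 -> red (q1 + q2).
  case=> f1 s1 e1 [f2 s2 e2]; exists (f1 + f2) => [m /msuppD_le|j].
    by rewrite mem_cat => /orP[/s1|/s2].
  by rewrite !mevalD e1 e2.
have redZ c q : red q -> red (c *: q).
  case=> f s e; exists (c *: f) => [m /msuppZ_le /s //|j].
  by rewrite !mevalZ e.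
have red_sum (r : seq 'X_{1..N}) (P : pred _) (F : _ -> {mpoly K[N]}) :
    (forall m, m \in r -> P m -> red (F m)) -> red (\sum_(m <- r | P m) F m).
  move=> h'; rewrite big_seq_cond; apply: (big_ind red) => // m /andP[].
  exact: h'.
suff redX m : (mdeg m <= d)%N -> red 'X_[m].
  by rewrite -/(red h) [h]mpolyE; apply: red_sum => m /hd md _; apply/redZ/redX.
elim/(well_founded_ind (@ltom_wf N)): m => m IH md.
case: (boolP (standard G m)) => [sm|].
  by exists 'X_[m] => // m'; rewrite msuppX inE => /eqP ->; rewrite sm.
case/allPn => g gG; rewrite negbK => gm.
have g0 : g != 0 by apply: contraNneq G0 => <-.
have lg0 : mleadc g != 0 by rewrite mleadc_eq0.
pose u := (m - mlead g)%MM; have mE : (mlead g + u)%MM = m by rewrite addmC submK.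
have [f fs fe] : red (\sum_(m' <- msupp g | m' != mlead g)
    (- (g@_m' / mleadc g)) *: 'X_[(m' + u)%MM]).
  apply: red_sum => m' m'g m'l.
  have lt_m' : ((m' + u)%MM < m)%O.
    by rewrite -mE ltmc_add2l lt_neqAle m'l msupp_le_mlead.
  by apply/redZ/IH => //; apply: leq_trans md; apply/lemc_mdeg/ltW.
exists f => // j; rewrite -fe.
have := Gp _ gG j; rewrite {1}[g]mpolyE (bigD1_seq (mlead g)) ?msupp_uniq ?mlead_supp //=.
rewrite mevalD mevalZ => /(congr1 (fun x => x * 'X_[u].@[p j] / mleadc g)).
rewrite !mul0r !mulrDl -!mulrA [X in X + _]mulrC -!mulrA mulVf // mulr1.
rewrite -mevalM -mpolyXD mE => /eqP; rewrite addr_eq0 => /eqP ->.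
rewrite !raddf_sum /= mulr_suml -sumrN; apply: eq_bigr => m' _.
by rewrite !mevalZ mpolyXD mevalM mulNr ['X_[u].@[_] / _]mulrC mulrACA.
Qed.

(** Lagrange interpolation, with one factor for each j != i in a coordinate where the two points
    differ; the default factor 1 arises only for j = i. *)
Lemma separating_poly z (p : 'I_z -> 'I_N -> K) i :
  (forall j, p i =1 p j -> i = j) ->
  exists f : {mpoly K[N]}, forall j, f.@[p j] = (i == j)%:R.
Proof.
move=> inj_p.
pose l j : {mpoly K[N]} :=
  if [pick a | p i a != p j a] is Some a
  then (p i a - p j a)^-1 *: ('X_a - (p j a)%:MP) else 1.
exists (\prod_(j | j != i) l j) => j; rewrite rmorph_prod /=.
have [<-|ij] := eqVneq.
  apply: big1 => j' j'i; rewrite /l; case: pickP => [a ha|_]; last exact: meval1.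
  by rewrite mevalZ mevalB mevalXU mevalC mulVf // subr_eq0.
rewrite (bigD1 j) 1?eq_sym //= [X in X * _](_ : _ = 0) ?mul0r //.
rewrite /l; case: pickP => [a ha|e].
  by rewrite mevalZ mevalB mevalXU mevalC subrr mulr0.
by case/eqP: ij; apply: inj_p => a; apply/eqP; rewrite -[_ == _]negbK e.
Qed.

(** Standard monomials span all functions on the points, since every indicator function reduces to a
    combination of them; so the evaluation matrix has rank z. *)
Lemma footprint_bound z (p : 'I_z -> 'I_N -> K) G (L : seq 'X_{1..N}) :
  0 \notin G -> {in G, forall g, forall j, g.@[p j] = 0} ->
  (forall i j, p i =1 p j -> i = j) -> uniq L ->
  (forall m, standard G m -> m \in L) -> (z <= size L)%N.
Proof.
move=> G0 Gp inj_p uL GL.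
pose E : 'M[K]_(size L, z) := \matrix_(a, j) 'X_[nth 0%MM L a].@[p j].
suff: row_full E by move/eqP <-; rewrite rank_leq_row.
rewrite -sub1mx; apply/row_subP => i.
have [h hi] := separating_poly (inj_p i).
have hd : {in msupp h, forall m, mdeg m <= (msize h).-1}%N.
  by move=> m /msize_mdeg_lt; lia.
have [f fs fe] := standard_reduction G0 Gp hd.
apply/submxP; exists (\row_a f@_(nth 0%MM L a)); apply/rowP => j.
rewrite !mxE -hi fe {1}(@mpolyE_sub _ _ f L uL) => [|m /fs/andP[/GL]//].
rewrite raddf_sum /= (big_nth 0%MM) big_mkord; apply: eq_bigr => a _.
by rewrite !mxE mevalZ.
Qed.
End Footprint.

(** * Lower bound for functions on a grid *)

Lemma all2_nthP (e : rel nat) (x y : seq nat) :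
  reflect (size x = size y /\ forall i, (i < size y)%N -> e (nth 0%N x i) (nth 0%N y i))
          (all2 e x y).
Proof.
elim: x y => [|a x IH] [|b y] /=.
- by constructor.
- by constructor; case.
- by constructor; case.
apply: (iffP andP) => [[ab /IH[-> h]]|[[sz] h]].
  by split=> // -[|i] // /h.
by split; [apply: (h 0%N)|apply/IH; split=> // i /(h i.+1)].
Qed.

Lemma mem_box s x : (x \in box s) = all2 ltn x s.
Proof.
elim: s x => [|c s IH] [|i x] //; first by rewrite mem_box0.
by rewrite mem_box_cons IH.
Qed.

(** * Exponent vectors as monomials free of the last variable *)

Section MonomialOfSeq.
Variable n : nat.

Definition mnm_of (x : seq nat) : 'X_{1..n.+1} :=
  [multinom (if unlift ord_max j is Some i then nth 0%N x i else 0%N) | j < n.+1].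

Lemma mnm_of_lift x i : mnm_of x (lift ord_max i) = nth 0%N x i.
Proof. by rewrite mnmE liftK. Qed.

Lemma mnm_of_max x : mnm_of x ord_max = 0%N.
Proof. by rewrite mnmE unlift_none. Qed.

Lemma mnm_of_inj : {in [pred x | size x == n] &, injective mnm_of}.
Proof.
move=> x y /eqP xn /eqP yn /mnmP e; apply: (@eq_from_nth _ 0%N).
  by rewrite xn yn.
move=> i; rewrite xn => li; have := e (lift ord_max (Ordinal li)).
by rewrite !mnm_of_lift.
Qed.

Lemma mnm_of_le x y : size y = n -> all2 leq x y -> (mnm_of x <= mnm_of y)%MM.
Proof.
move=> yn /all2_nthP[_ h]; apply/mnm_lepP => j.
case: (unliftP ord_max j) => [i ->|->]; last by rewrite !mnm_of_max.
by rewrite !mnm_of_lift h // yn.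
Qed.

Lemma mdeg_mnm_of x : size x = n -> mdeg (mnm_of x) = sumn x.
Proof.
move=> xn; rewrite mdegE big_ord_recr /= mnm_of_max addn0 sumnE (big_nth 0%N).
rewrite xn big_mkord; apply: eq_bigr => i _; rewrite -mnm_of_lift; congr (mnm_of _ _).
by apply: val_inj; rewrite /= /bump leqNgt ltn_ord.
Qed.

Lemma mem_mnm_of (s : seq nat) (m : 'X_{1..n.+1}) :
  size s = n -> m ord_max = 0%N ->
  (forall i : 'I_n, (m (lift ord_max i) < nth 0%N s i)%N) ->
  m \in map mnm_of (box s).
Proof.
move=> sn m0 ms; pose x := [seq m (lift ord_max i) | i <- enum 'I_n].
have xn (i : 'I_n) : nth 0%N x i = m (lift ord_max i).
  by rewrite (nth_map i) ?size_enum_ord // nth_ord_enum.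
apply/mapP; exists x.
  rewrite mem_box; apply/all2_nthP; split; first by rewrite size_map size_enum_ord.
  by rewrite sn => i li; have := ms (Ordinal li); rewrite -xn.
apply/mnmP => j; case: (unliftP ord_max j) => [i ->|->].
  by rewrite mnm_of_lift xn.
by rewrite mnm_of_max.
Qed.

End MonomialOfSeq.

(** * Leading monomials of products of linear factors *)

Section LinearFactors.
Variables (K : fieldType) (N : nat).

Lemma mlead_XsubC (i : 'I_N) (c : K) : mlead ('X_i - c%:MP) = U_(i)%MM.
Proof.
rewrite mleadDl ?mleadXm // mleadN mleadC.
by rewrite lt_mdeg_ltmc // mdeg0 mdeg1.
Qed.

Lemma XsubC_neq0 (i : 'I_N) (c : K) : 'X_i - c%:MP != 0 :> {mpoly K[N]}.
Proof.
apply/eqP => h; have := mlead_XsubC i c; rewrite h mlead0 => /mnmP /(_ i).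
by rewrite mnm0E mnm1E eqxx.
Qed.

Lemma mlead_prod_XsubC (i : 'I_N) (r : seq K) :
  mlead (\prod_(a <- r) ('X_i - a%:MP)) = (U_(i) *+ size r)%MM.
Proof.
elim: r => [|a r IH]; first by rewrite big_nil mlead1 mulm0n.
rewrite big_cons mleadM ?XsubC_neq0 //.
  by rewrite mlead_XsubC IH mulmS.
by rewrite prodf_seq_neq0; apply/allP => b _ /=; rewrite XsubC_neq0.
Qed.

End LinearFactors.

(** * The footprint bound on a Cartesian grid *)

Section CartesianLowerBound.
Variables (K : finFieldType) (n : nat) (A : nat -> {set K}).

Definition side_lengths := [seq #|A i| | i <- iota 1 n].

(* The factor x_max - 1 makes dehomogenization part of the reduction. *)
Definition grid_ideal : seq {mpoly K[n.+1]} :=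
  ('X_ord_max - 1%:MP) ::
  [seq \prod_(a <- enum (A i.+1)) ('X_(lift ord_max i) - a%:MP) | i : 'I_n].

(** The representatives with last coordinate 1 of the points of [pcartesian]. *)
Definition grid : {set 'rV[K]_n.+1} :=
  [set x : 'rV[K]_n.+1 |
     [forall i : 'I_n, x 0 (lift ord_max i) \in A i.+1] && (x 0 ord_max == 1)].

Lemma grid_ideal_neq0 : 0 \notin grid_ideal.
Proof.
rewrite inE eq_sym (negbTE (XsubC_neq0 _ _)) /=; apply/negP => /mapP[i _].
apply/eqP; rewrite eq_sym prodf_seq_neq0.
by apply/allP => b _ /=; rewrite XsubC_neq0.
Qed.

Lemma grid_ideal_vanish g x : g \in grid_ideal -> x \in grid -> g.@[x 0] = 0.
Proof.
rewrite !inE => /predU1P[->|/mapP[i _ ->]] /andP[/forallP xA /eqP x1].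
  by rewrite mevalB mevalXU mevalC x1 subrr.
rewrite rmorph_prod /= (bigD1_seq (x 0 (lift ord_max i))) ?enum_uniq ?mem_enum //=.
by rewrite mevalB mevalXU mevalC subrr mul0r.
Qed.

(** The leading monomials of [grid_ideal] are x_max and the powers x_i^(d_i). *)
Lemma grid_ideal_standard m :
  standard grid_ideal m -> m \in map (mnm_of n) (box side_lengths).
Proof.
case/andP=> m1 /allP mA; apply: mem_mnm_of; first by rewrite size_map size_iota.
  apply/eqP; rewrite -leqn0 leqNgt; apply: contra m1 => m1.
  apply/mnm_lepP => j; rewrite mlead_XsubC mnm1E.
  by case: eqP => [<-|].
move=> i; rewrite (nth_map 0%N) ?size_iota // nth_iota // add1n ltnNge.
have := mA _ (map_f _ (mem_enum _ i)); apply: contra => mi.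
apply/mnm_lepP => j; rewrite mlead_prod_XsubC mulmnE mnm1E -cardE.
by case: eqP => [<-|]; rewrite ?mul1n ?mul0n.
Qed.

Lemma cartesian_footprint m d r (p : 'I_m -> 'rV[K]_n.+1)
    (h : 'I_r -> {mpoly K[n.+1]}) (Z : {set 'I_m}) :
  (0 < d)%N -> (0 < r)%N ->
  sorted leq side_lengths -> all (leq 1) side_lengths ->
  injective p -> (forall j, p j \in grid) ->
  (forall t, {in msupp (h t), forall m, mdeg m <= d}%N) ->
  (forall u : 'rV[K]_r, (forall j, \sum_t u 0 t * (h t).@[p j 0] = 0) -> u = 0) ->
  (forall t j, j \in Z -> (h t).@[p j 0] = 0) ->
  (#|Z| + wt side_lengths d r <= prodseq side_lengths)%N.
Proof.
move=> d0 r0 srt s1 p_inj pX hd hfree hZ.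
have szs : size side_lengths = n by rewrite size_map size_iota.
have Gp : {in grid_ideal, forall g, forall j, g.@[p j 0] = 0}.
  by move=> g gG j; apply: grid_ideal_vanish.
have [f fs fe] := fin_all_exists2 (fun t => standard_reduction grid_ideal_neq0 Gp (hd t)).
pose F (u : 'rV[K]_r) := \sum_t u 0 t *: f t.
have Fp u j : (F u).@[p j 0] = \sum_t u 0 t * (h t).@[p j 0].
  by rewrite raddf_sum; apply: eq_bigr => t _; rewrite /= mevalZ fe.
have F0 u : u != 0 -> F u != 0.
  apply: contraNneq => Fu; apply/eqP/hfree => j.
  by rewrite -Fp Fu meval0.
have Fs u m' : m' \in msupp (F u) -> standard grid_ideal m' && (mdeg m' <= d)%N.
  move/msupp_sum_le => /flattenP[_ /mapP[t _ ->]] /msuppZ_le; exact: fs.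
(* Leading monomials of all nonzero combinations of the reduced polynomials. *)
pose Lead := [seq x <- box side_lengths |
   [exists u : 'rV[K]_r, (u != 0) && (mlead (F u) == mnm_of n x)]].
have LeadP x : x \in Lead -> exists2 u, u != 0 & mlead (F u) = mnm_of n x.
  by rewrite mem_filter => /andP[/existsP[u /andP[u0 /eqP e]] _]; exists u.
have r_le : (r <= size Lead)%N.
  pose C : 'M[K]_(r, size Lead) := \matrix_(t, a) (f t)@_(mnm_of n (nth [::] Lead a)).
  suff: row_free C by move/eqP => <-; rewrite rank_leq_col.
  (* A nonzero combination has a nonzero coefficient at its own leading monomial, which belongs to
     [Lead]. *)
  apply: inj_row_free => u uC; apply/eqP; apply: contraT => u0.
  have lF := mlead_supp (F0 _ u0).
  have /andP[/grid_ideal_standard /mapP[x xb lx] _] := Fs _ _ lF.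
  have xL : x \in Lead.
    by rewrite mem_filter xb andbT; apply/existsP; exists u; rewrite u0 lx eqxx.
  have xi : (index x Lead < size Lead)%N by rewrite index_mem.
  move/rowP/(_ (Ordinal xi)): uC; rewrite !mxE => e.
  case/negP: (F0 _ u0); rewrite -mleadc_eq0 lx raddf_sum; apply/eqP; rewrite -[RHS]e.
  by apply: eq_bigr => t _; rewrite /= mcoeffZ mxE nth_index.
pose S := take r Lead.
have szS : size S = r by rewrite size_takel.
have SL x : x \in S -> x \in Lead by apply: mem_take.
have Sb : {subset S <= box side_lengths}.
  by move=> x /SL; rewrite mem_filter => /andP[].
have uS : uniq S by apply/take_uniq/filter_uniq/box_uniq.
have szb x : x \in box side_lengths -> size x = n.
  by move/size_mem_box; rewrite szs.
have Sd : {in S, forall x, sumn x <= d}%N.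
  move=> x xS; have [u u0 e] := LeadP _ (SL _ xS).
  rewrite -(mdeg_mnm_of (szb _ (Sb _ xS))) -e.
  by have /andP[] := Fs _ _ (mlead_supp (F0 _ u0)).
have := @upset_card _ d S srt s1 d0 uS; rewrite szS => /(_ r0 Sb Sd) W.
apply: leq_trans (leq_add (leqnn _) W) _.
rewrite -size_box -(count_predC (upset S)) addnC leq_add2l.
(* All these polynomials vanish on [Z], and their standard monomials lie in the box outside the
   up-set of [S]. *)
pose G := grid_ideal ++ [seq F u | u <- enum (predC1 (0 : 'rV[K]_r))].
rewrite -size_filter -(size_map (mnm_of n)).
apply: (@footprint_bound K n.+1 _ (fun i => p (enum_val i) 0) G).
- rewrite mem_cat negb_or grid_ideal_neq0; apply/negP => /mapP[u].
  by rewrite mem_enum => /F0 /negP Fu /esym/eqP.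
- move=> g; rewrite mem_cat => /orP[gG i|/mapP[u _ ->] i]; first exact: Gp.
  by rewrite Fp big1 // => t _; rewrite hZ ?mulr0 // enum_valP.
- move=> i j e; apply: enum_val_inj; apply: p_inj; apply/rowP => a; exact: e.
- rewrite map_inj_in_uniq ?filter_uniq ?box_uniq // => x y.
  rewrite !mem_filter => /andP[_ /szb xn] /andP[_ /szb yn].
  by apply: mnm_of_inj; rewrite inE ?xn ?yn.
- move=> m'; rewrite /standard all_cat => /andP[/grid_ideal_standard/mapP[y yb ->]] /allP hy.
  apply: map_f; rewrite mem_filter yb andbT; apply/hasPn => x xS.
  have [u u0 e] := LeadP _ (SL _ xS).
  have /hy : F u \in [seq F u | u <- enum (predC1 (0 : 'rV[K]_r))].
    by apply: map_f; rewrite mem_enum.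
  by apply: contra; rewrite e; apply: mnm_of_le; apply: szb.
Qed.

End CartesianLowerBound.

(** * Closed form of the bound and the size of a grid *)

Lemma prodseq_iota (f : nat -> nat) a q :
  prodseq [seq f i | i <- iota a q] = (\prod_(a <= i < a + q) f i)%N.
Proof.
by rewrite /prodseq foldrE big_map /index_iota addKn.
Qed.

Lemma tailprod_iota (f : nat -> nat) a q j : (j <= q)%N ->
  tailprod [seq f i | i <- iota a q] j = (\prod_(a + j <= i < a + q) f i)%N.
Proof.
elim: j a q => [|j IH] a q; first by rewrite tailprod0 prodseq_iota addn0.
by case: q => // q jq /=; rewrite IH // !addSnnS.
Qed.

(** As l >= 1, the recursion of [wt] passes each of the first k sides, spending f i - 1 of the
    degree on it, and stops at the next side with l left. *)
Lemma wt_iota (f : nat -> nat) a q k l r :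
  (k < q)%N -> (0 < r <= q - k)%N -> (0 < l < f (a + k))%N ->
  (forall i, (a <= i < a + q)%N -> (0 < f i)%N) ->
  wt [seq f i | i <- iota a q] (\sum_(a <= i < a + k) (f i - 1) + l) r =
  ((f (a + k) - l + 1) * \prod_(a + k + 1 <= i < a + q) f i
     - \prod_(a + k + r <= i < a + q) f i)%N.
Proof.
elim: k a q => [|k IH] a q.
  case: q => // q _ /andP[r0 rq] /andP[l0 lf] _.
  rewrite addn0 big_geq // add0n in lf *.
  rewrite /wt /= lf tailprod_iota ?prodseq_iota; last by lia.
  have -> : (f a - l + 1 = (f a).+1 - l)%N by lia.
  have -> : (a.+1 + r.-1 = a + r)%N by lia.
  by rewrite addn1 addSnnS.
case: q => // q; rewrite !ltnS subSS => kq rq lf fpos.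
have fa : (0 < f a)%N by apply: fpos; lia.
rewrite big_ltn; last by lia.
rewrite -![(a + _.+1)%N]addSnnS in lf *.
have e1 : ((f a - 1 + \sum_(a.+1 <= i < a.+1 + k) (f i - 1) + l < f a) = false)%N.
  by apply/negbTE; rewrite -leqNgt; lia.
have := IH a.+1 q kq rq lf; rewrite /wt /= e1 => <-; last first.
  by move=> i ?; apply: fpos; lia.
have -> : (f a - 1 + \sum_(a.+1 <= i < a.+1 + k) (f i - 1) + l - (f a).-1 =
  \sum_(a.+1 <= i < a.+1 + k) (f i - 1) + l)%N by lia.
by [].
Qed.

Lemma dhomog_meval (R : comNzRingType) N d (h : {mpoly R[N]}) (c : R) (x : 'I_N -> R) :
  h \is d.-homog -> h.@[fun i => c * x i] = c ^+ d * h.@[x].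
Proof.
move=> /dhomogP hd; rewrite !mevalE mulr_sumr big_seq [RHS]big_seq.
apply: eq_bigr => m /hd dm; have {dm}<- : mdeg m = d := dm; rewrite mulrCA; congr (_ * _).
by rewrite mdegE -prodrXr -big_split; apply: eq_bigr => i _; rewrite exprMn.
Qed.

Section Grid.
Variables (K : finFieldType) (n : nat).
Implicit Type V : nat -> {set K}.

Definition row_of (f : {ffun 'I_n -> K}) : 'rV[K]_n.+1 :=
  \row_j (if unlift ord_max j is Some i then f i else 1).

Lemma row_of_inj : injective row_of.
Proof.
move=> f g /rowP e; apply/ffunP => i.
by have := e (lift ord_max i); rewrite !mxE liftK.
Qed.

Lemma gridE V : grid n V = row_of @: family (fun i : 'I_n => V i.+1).
Proof.
apply/setP => x; rewrite inE; apply/andP/imsetP => [[/forallP xV /eqP x1]|[f + ->]].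
  exists [ffun i => x 0 (lift ord_max i)].
    by apply/familyP => i; rewrite ffunE.
  apply/rowP => j; rewrite mxE; case: (unliftP ord_max j) => [i ->|->].
    by rewrite ffunE.
  by [].
move/familyP=> fV; split; last by rewrite mxE unlift_none.
by apply/forallP => i; rewrite mxE liftK fV.
Qed.

Lemma card_grid V : #|grid n V| = (\prod_(1 <= i < n.+1) #|V i|)%N.
Proof.
rewrite gridE card_imset ?card_family; last exact: row_of_inj.
rewrite foldrE big_map big_enum /= big_add1 big_mkord.
by [].
Qed.

Lemma grid_sub V V' :
  (forall i, (1 <= i <= n)%N -> V i \subset V' i) -> grid n V \subset grid n V'.
Proof.
move=> h; apply/subsetP => x; rewrite !inE => /andP[/forallP xV ->].
by rewrite andbT; apply/forallP => i; apply: (subsetP (h _ _)); rewrite ?xV //=.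
Qed.

End Grid.

(** * Polynomials of low weight *)

Section LowWeight.
Variables (K : finFieldType) (n : nat) (A : nat -> {set K}) (k l r : nat).
Hypotheses (A2 : forall i, (1 <= i <= n)%N -> (2 <= #|A i|)%N).
Hypotheses (r0 : (0 < r)%N) (krn : (k + r <= n)%N).
Hypotheses (lA : (0 < l < #|A k.+1|)%N).

(** [base_pt] and [other_pt] are the last two elements of A_i. The first l - 1 <= #|A k.+1| - 2
    elements, which form [cut_set], avoid both. *)
Definition base_pt i : K := nth 0 (enum (A i)) #|A i|.-1.
Definition other_pt i : K := nth 0 (enum (A i)) #|A i|.-2.
Definition cut_set : {set K} := [set x in take l.-1 (enum (A k.+1))].
Definition root_set i : {set K} :=
  if (i <= k)%N then A i :\ base_pt i else if i == k.+1 then cut_set else set0.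
(** The sides of the grid where [core_poly] does not vanish; [base_side] cuts out the part of it
    where the r extra factors vanish too. *)
Definition open_side i := A i :\: root_set i.
Definition base_side i : {set K} :=
  if (k < i <= k + r)%N then [set base_pt i] else open_side i.

Definition linear_form (i : 'I_n) (a : K) : {mpoly K[n.+1]} :=
  'X_(lift ord_max i) - a *: 'X_ord_max.

(** Ordinals count from 0, so this is the variable x_(k+t+1), paired with A_(k+t+1). *)
Definition pivot_var (t : 'I_r) : 'I_n :=
  Ordinal (leq_trans (leq_trans (eq_leq (esym (addnS k t)))
            (leq_add (leqnn k) (ltn_ord t))) krn).

Definition core_poly : {mpoly K[n.+1]} :=
  \prod_(i < n) \prod_(a in root_set i.+1) linear_form i a.
Definition low_weight_poly (t : 'I_r) :=
  core_poly * linear_form (pivot_var t) (base_pt (pivot_var t).+1).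

Lemma base_other_neq i : (1 <= i <= n)%N -> base_pt i != other_pt i.
Proof.
move/A2=> h; rewrite nth_uniq ?enum_uniq -?cardE; lia.
Qed.

Lemma notin_cut_set j :
  (l.-1 <= j < #|A k.+1|)%N -> nth 0 (enum (A k.+1)) j \notin cut_set.
Proof.
move=> /andP[lj jA]; rewrite inE in_take_leq; last by rewrite -cardE; lia.
by rewrite index_uniq -?cardE ?enum_uniq // -leqNgt.
Qed.

Lemma card_cut_set : #|cut_set| = l.-1.
Proof.
rewrite cardsE; have /card_uniqP -> : uniq (take l.-1 (enum (A k.+1))).
  exact/take_uniq/enum_uniq.
by rewrite size_takel // -cardE; lia.
Qed.

Lemma cut_set_sub : cut_set \subset A k.+1.
Proof. by apply/subsetP => x; rewrite inE => /mem_take; rewrite mem_enum. Qed.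

Lemma mem_nthA i j : (j < #|A i|)%N -> nth 0 (enum (A i)) j \in A i.
Proof. by move=> jA; rewrite -mem_enum mem_nth // -cardE. Qed.

Lemma base_pt_in i : (1 <= i <= n)%N -> base_pt i \in open_side i.
Proof.
move=> h; have Ai := A2 h; rewrite inE mem_nthA ?andbT; last by lia.
rewrite /root_set; case: ifP => _; first by rewrite !inE eqxx.
by case: eqP Ai => [->|_] Ai; [apply: notin_cut_set; lia|rewrite inE].
Qed.

Lemma other_pt_in i : (k < i <= n)%N -> other_pt i \in open_side i.
Proof.
move=> h; have Ai : (2 <= #|A i|)%N by apply: A2; lia.
rewrite inE mem_nthA ?andbT; last by lia.
rewrite /root_set leqNgt; case/andP: h => -> _ /=.
by case: eqP Ai => [->|_] Ai; [apply: notin_cut_set; lia|rewrite inE].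
Qed.

Lemma card_open_side i : (1 <= i <= n)%N ->
  #|open_side i| = (if i <= k then 1 else if i == k.+1 then #|A i| - l + 1 else #|A i|)%N.
Proof.
move=> h; have Ai := A2 h; rewrite /open_side /root_set; case: ifP => [ik|_].
  suff -> : A i :\: (A i :\ base_pt i) = [set base_pt i] by rewrite cards1.
  have bA : base_pt i \in A i by apply: mem_nthA; lia.
  apply/setP => x; rewrite !inE; case: eqVneq => [->|_] //=.
  by case: (x \in A i).
case: eqP => [->|_]; last by rewrite setD0.
by rewrite cardsD (setIidPr cut_set_sub) card_cut_set; lia.
Qed.

Lemma card_root_set i : (1 <= i <= n)%N ->
  #|root_set i| = (if i <= k then #|A i| - 1 else if i == k.+1 then l.-1 else 0)%N.
Proof.
move=> h; have Ai := A2 h; rewrite /root_set; case: ifP => [ik|_].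
  have bA : base_pt i \in A i by apply: mem_nthA; lia.
  by rewrite (cardsD1 (base_pt i) (A i)) bA addKn.
by case: eqP => _; rewrite ?card_cut_set ?cards0.
Qed.

Lemma linear_form_homog i a : linear_form i a \is 1.-homog.
Proof. by rewrite rpredB ?rpredZ // dhomogX; apply/eqP; exact: mdeg1. Qed.

Lemma linear_form_eval i a (x : 'rV[K]_n.+1) :
  x \in grid n A -> (linear_form i a).@[x 0] = x 0 (lift ord_max i) - a.
Proof.
rewrite inE => /andP[_ /eqP x1].
by rewrite mevalB mevalZ !mevalXU x1 mulr1.
Qed.

(** There are d_i - 1 factors for each i <= k, l - 1 for i = k + 1, and one extra factor. *)
Lemma low_weight_poly_homog t :
  low_weight_poly t \is (\sum_(1 <= i < k.+1) (#|A i| - 1) + l)%N.-homog.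
Proof.
have -> : (\sum_(1 <= i < k.+1) (#|A i| - 1) + l =
           \sum_(i < n) \sum_(a in root_set i.+1) 1 + 1)%N.
  have -> : (\sum_(i < n) \sum_(a in root_set i.+1) 1 = \sum_(1 <= i < n.+1) #|root_set i|)%N.
    by rewrite big_add1 big_mkord; apply: eq_bigr => i _; rewrite sum1_card.
  rewrite [in RHS](@big_cat_nat _ _ _ k.+1) //=; last by lia.
  rewrite (@big_ltn _ _ _ k.+1); last by lia.
  rewrite [X in (_ + (_ + X) + 1)%N]big_nat_cond [X in (_ + (_ + X) + 1)%N]big1; last first.
    by move=> i h; rewrite card_root_set; [rewrite !ifN //|]; lia.
  rewrite card_root_set; last by lia.
  rewrite ltnn eqxx -addnA; congr (_ + _)%N; last by lia.
  rewrite big_nat_cond [RHS]big_nat_cond; apply: eq_bigr => i h.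
  by rewrite card_root_set; [rewrite ifT //|]; lia.
apply: dhomogM; last exact: linear_form_homog.
apply: (big_ind2 (fun (p : {mpoly K[n.+1]}) d => p \is d.-homog)).
- exact: dhomog1.
- by move=> *; apply: dhomogM.
move=> i _; apply: (big_ind2 (fun (p : {mpoly K[n.+1]}) d => p \is d.-homog)).
- exact: dhomog1.
- by move=> *; apply: dhomogM.
- by move=> a _; apply: linear_form_homog.
Qed.

Lemma core_poly_neq0 x :
  x \in grid n A -> (core_poly.@[x 0] != 0) = (x \in grid n open_side).
Proof.
move=> xA; have := xA; rewrite !inE => /andP[/forallP xAi ->]; rewrite andbT.
rewrite rmorph_prod; apply/prodf_neq0/forallP => h i.
  rewrite inE xAi andbT; apply/negP => xE; have := h i isT.
  rewrite /= rmorph_prod /= (bigD1 _ xE) /= linear_form_eval // subrr mul0r.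
  by rewrite eqxx.
move=> _; rewrite /= rmorph_prod; apply/prodf_neq0 => a aE /=.
rewrite linear_form_eval // subr_eq0; apply: contraTneq aE => <-.
by have := h i; rewrite inE => /andP[].
Qed.

Lemma low_weight_poly_support t x : x \in grid n A -> (low_weight_poly t).@[x 0] != 0 ->
  x \in grid n open_side :\: grid n base_side.
Proof.
move=> xA; rewrite mevalM mulf_eq0 negb_or core_poly_neq0 // => /andP[xV].
rewrite linear_form_eval // subr_eq0 inE xV andbT; apply: contra.
rewrite inE => /andP[/forallP /(_ (pivot_var t))] + _.
by rewrite /base_side ifT ?inE //= ltnS leq_addr ltn_add2l ltn_ord.
Qed.

Lemma open_side_sub i : open_side i \subset A i.
Proof. exact: subsetDl. Qed.

(** Both grids are products and the second is contained in the first: it has sides 1 up to index k +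
    r and full sides beyond. *)
Lemma card_low_weight_support :
  #|grid n open_side :\: grid n base_side| =
  ((#|A k.+1| - l + 1) * \prod_(k + 2 <= i < n.+1) #|A i|
     - \prod_(k + r + 1 <= i < n.+1) #|A i|)%N.
Proof.
have WV : grid n base_side \subset grid n open_side.
  apply: grid_sub => i h; rewrite /base_side; case: ifP => // _.
  by rewrite sub1set base_pt_in.
rewrite cardsD (setIidPr WV) !card_grid; congr (_ - _)%N.
  rewrite (@big_cat_nat _ _ _ k.+1) //=; last by lia.
  rewrite big_nat_cond big1 ?mul1n => [|i h]; last first.
    by rewrite card_open_side; [rewrite ifT //|]; lia.
  rewrite big_ltn; last by lia.
  rewrite card_open_side; last by lia.
  rewrite ltnn eqxx addn2; congr (_ * _)%N.
  rewrite big_nat_cond [RHS]big_nat_cond; apply: eq_bigr => i h.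
  by rewrite card_open_side; [rewrite !ifN //|]; lia.
rewrite (@big_cat_nat _ _ _ (k + r + 1)) //=; [|lia|lia].
rewrite big_nat_cond big1 ?mul1n => [|i h].
  rewrite big_nat_cond [RHS]big_nat_cond; apply: eq_bigr => i h.
  by rewrite /base_side ifN; [rewrite card_open_side; [rewrite !ifN //|]|]; lia.
rewrite /base_side; case: ifP => hi; first by rewrite cards1.
by rewrite card_open_side; [rewrite ifT //|]; lia.
Qed.

(** The witness has all coordinates at the base points except the pivot of t, so every other extra
    factor vanishes. This yields linear independence. *)
Lemma low_weight_poly_separated t : exists2 y, y \in grid n A &
  forall t', ((low_weight_poly t').@[y 0] != 0) = (t' == t).
Proof.
pose y := row_of [ffun i : 'I_n =>
  if i == pivot_var t then other_pt i.+1 else base_pt i.+1].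
have yE i : y 0 (lift ord_max i) = if i == pivot_var t then other_pt i.+1 else base_pt i.+1.
  by rewrite mxE liftK ffunE.
have yV : y \in grid n open_side.
  rewrite inE mxE unlift_none eqxx andbT; apply/forallP => i; rewrite yE.
  case: eqP => [->|_]; last by apply: base_pt_in; exact: ltn_ord.
  by apply: other_pt_in; rewrite ltn_ord andbT /= ltnS leq_addr.
have yA : y \in grid n A by apply: (subsetP (grid_sub _)) yV => i _; exact: open_side_sub.
exists y => // t'; rewrite mevalM mulf_eq0 negb_or core_poly_neq0 // yV /=.
rewrite linear_form_eval // subr_eq0 yE.
have -> : (pivot_var t' == pivot_var t) = (t' == t).
  by rewrite -!val_eqE /= eqn_add2l.
case: (eqVneq t' t) => [->|_]; last by rewrite eqxx.
by rewrite eq_sym base_other_neq //; exact: (ltn_ord (pivot_var t)).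
Qed.

Theorem low_weight_polys :
  exists (G : 'I_r -> {mpoly K[n.+1]}) (Y : {set 'rV[K]_n.+1}),
    [/\ forall t, G t \is (\sum_(1 <= i < k.+1) (#|A i| - 1) + l)%N.-homog,
        forall t x, x \in grid n A -> (G t).@[x 0] != 0 -> x \in Y,
        forall t, exists2 y, y \in grid n A &
          forall t', ((G t').@[y 0] != 0) = (t' == t)
      & #|Y| = ((#|A k.+1| - l + 1) * \prod_(k + 2 <= i < n.+1) #|A i|
                  - \prod_(k + r + 1 <= i < n.+1) #|A i|)%N].
Proof.
exists low_weight_poly, (grid n open_side :\: grid n base_side); split.
- exact: low_weight_poly_homog.
- exact: low_weight_poly_support.
- exact: low_weight_poly_separated.
- exact: card_low_weight_support.
Qed.

End LowWeight.

(** * Reed-Muller-type codes *)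

Section NormalizedPoints.
Variables (K : finFieldType) (n : nat) (A : nat -> {set K}).

Lemma ppoint_grid_inj : {in grid n A &, injective (@ppoint K n)}.
Proof.
move=> x y; rewrite !inE => /andP[_ /eqP x1] /andP[_ /eqP y1] /eqP/ppoint_eqP[c _ e].
have := congr1 (fun z : 'rV_n.+1 => z 0 ord_max) e.
by rewrite mxE x1 y1 mulr1 => c1; rewrite e -c1 scale1r.
Qed.

Lemma pcartesianE : pcartesian n A = [set ppoint x | x in grid n A].
Proof. by []. Qed.

Lemma card_pcartesian : #|pcartesian n A| = #|grid n A|.
Proof. by rewrite pcartesianE card_in_imset //; exact: ppoint_grid_inj. Qed.

Variable P : 'I_#|pcartesian n A| -> 'rV[K]_n.+1.
Hypothesis PX : [set ppoint (P i) | i in 'I_#|pcartesian n A|] = pcartesian n A.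

Definition normalized i := (P i 0 ord_max)^-1 *: P i.

Lemma normalizedP i :
  [/\ P i 0 ord_max != 0, P i = P i 0 ord_max *: normalized i
    & normalized i \in grid n A].
Proof.
have : ppoint (P i) \in pcartesian n A by rewrite -PX; apply: imset_f.
rewrite pcartesianE => /imsetP[x xA /esym/eqP/ppoint_eqP[c c0 Pi]].
have Pc : P i 0 ord_max = c.
  by rewrite Pi mxE; move: xA; rewrite inE => /andP[_ /eqP ->]; rewrite mulr1.
have nx : normalized i = x by rewrite /normalized Pc Pi scalerA mulVf // scale1r.
by rewrite nx Pc; split.
Qed.

Lemma normalized_inj : injective normalized.
Proof.
move=> i j e; have [i0 Pi _] := normalizedP i; have [j0 Pj _] := normalizedP j.
(* A family of m indices whose image has m elements is injective. *)
have /imset_injP inj_P :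
    #|[set ppoint (P i) | i in 'I_#|pcartesian n A|]| == #|'I_(#|pcartesian n A|)|.
  by rewrite PX card_ord.
apply: inj_P => //; apply/eqP/ppoint_eqP.
exists (P j 0 ord_max / P i 0 ord_max); first by rewrite mulf_neq0 ?invr_eq0.
by rewrite {2}Pi scalerA divfK // e -Pj.
Qed.

Lemma normalized_surj x : x \in grid n A -> exists i, x = normalized i.
Proof.
move=> xA; suff : x \in normalized @: 'I_#|pcartesian n A|.
  by case/imsetP=> i _ ->; exists i.
suff /eqP-> : normalized @: 'I_#|pcartesian n A| == grid n A by [].
rewrite eqEcard (card_imset _ normalized_inj) card_ord -card_pcartesian leqnn andbT.
by apply/subsetP => _ /imsetP[i _ ->]; case: (normalizedP i).
Qed.

Variables (d : nat) (h_ : 'I_#|pcartesian n A| -> dhomog n.+1 K d).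
Hypothesis h0 : forall i, (h_ i).@[P i 0] != 0.

(** By homogeneity, changing representatives only rescales each coordinate by a nonzero constant,
    which preserves supports and dimensions. *)
Lemma rm_evalE : exists2 c : 'I_#|pcartesian n A| -> K, forall i, c i != 0 &
  forall (h : dhomog n.+1 K d) i,
    rm_eval P h_ h 0 i = c i * (h : {mpoly K[n.+1]}).@[normalized i 0].
Proof.
exists (fun i => P i 0 ord_max ^+ d / (h_ i).@[P i 0]) => [i|h i].
  by have [? _ _] := normalizedP i; rewrite mulf_neq0 ?invr_eq0 ?expf_neq0.
rewrite mxE mulrAC; congr (_ / _); have [_ Pi _] := normalizedP i.
rewrite -dhomog_meval; last exact: dhomog_is_dhomog.
by apply: meval_eq => j; rewrite {1}Pi mxE.
Qed.

Lemma ghw_lower r (D : {vspace 'rV[K]_#|pcartesian n A|}) :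
  (0 < d)%N -> (0 < r)%N -> sorted leq (side_lengths n A) ->
  all (leq 1) (side_lengths n A) ->
  (D <= rm_code P h_)%VS -> \dim D = r ->
  (wt (side_lengths n A) d r <= #|code_support D|)%N.
Proof.
move=> d0 + srt s1 DC dD; rewrite -dD => r0.
have [c c0 evE] := rm_evalE.
have exh (t : 'I_(\dim D)) : exists h, (vbasis D)`_t = rm_eval P h_ h.
  apply/rm_codeP; apply: (subvP DC).
  by apply: vbasis_mem; rewrite mem_nth // size_tuple.
have [h hE] := fin_all_exists exh.
(* The polynomials come from a basis of D; their common zeros contain the complement of the
   support. *)
have := @cartesian_footprint K n A _ d (\dim D) normalized
  (fun t => (h t : {mpoly K[n.+1]})) (~: code_support D) d0 r0 srt s1 normalized_inj.
move=> H; have {}H := H _ _ _ _.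
have {H} : (#|~: code_support D| + wt (side_lengths n A) d (\dim D) <=
   prodseq (side_lengths n A))%N.
  apply: H.
  - by move=> j; case: (normalizedP j).
  - move=> t m mt; apply: eq_leq; have /dhomogP := dhomog_is_dhomog (h t).
    by apply.
  - move=> u uh; have /freeP fD : free (vbasis D) by apply: basis_free (vbasisP D).
    apply/rowP => t; rewrite mxE; apply: (fD (u 0)); apply/rowP => j.
    transitivity (c j * (\sum_t u 0 t * (h t).@[normalized j 0])).
      by rewrite summxE mulr_sumr; apply: eq_bigr => t' _; rewrite mxE hE evE mulrCA.
    by rewrite uh mulr0 mxE.
  - move=> t j; rewrite inE inE negb_exists => /forallP /(_ (vbasis D)`_t).
    rewrite vbasis_mem ?mem_nth ?size_tuple //= negbK hE evE mulf_eq0 (negbTE (c0 j)).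
    by move/eqP.
rewrite prodseq_iota add1n -card_grid -card_pcartesian.
rewrite -[X in (_ <= X)%N]card_ord -(cardsC (code_support D)).
by rewrite addnC leq_add2r.
Qed.

(** The words of the r polynomials span D: the separating points make them independent, and all of
    them vanish outside Y. *)
Lemma ghw_upper r (G : 'I_r -> {mpoly K[n.+1]}) (Y : {set 'rV[K]_n.+1}) :
  (forall t, G t \is d.-homog) ->
  (forall t x, x \in grid n A -> (G t).@[x 0] != 0 -> x \in Y) ->
  (forall t, exists2 y, y \in grid n A &
     forall t', ((G t').@[y 0] != 0) = (t' == t)) ->
  exists D, [/\ (D <= rm_code P h_)%VS, \dim D = r & (#|code_support D| <= #|Y|)%N].
Proof.
move=> Gd GY Gsep; have [c c0 evE] := rm_evalE.
pose b := [tuple rm_eval P h_ (DHomog (Gd t)) | t < r].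
have bE (t : 'I_r) : b`_t = rm_eval P h_ (DHomog (Gd t)).
  by rewrite -tnth_nth tnth_mktuple.
exists <<b>>%VS; split.
- apply/span_subvP => _ /mapP[t _ ->]; apply/rm_codeP; by eexists.
- suff /eqP-> : free b by rewrite size_tuple.
  apply/freeP => u ub t; have [y yA yt] := Gsep t.
  have [j yj] := normalized_surj yA.
  move/rowP/(_ j): ub; rewrite summxE mxE (bigD1 t) //= big1 => [|t' t't].
    rewrite addr0 mxE bE evE /= -yj => /eqP.
    have := yt t; rewrite eqxx !mulf_eq0 (negbTE (c0 j)) => /negbTE ->.
    by rewrite !orbF => /eqP.
  rewrite mxE bE evE /= -yj; have := yt t'; rewrite (negbTE t't) => /negbFE/eqP ->.
  by rewrite !mulr0.
rewrite -(card_imset _ normalized_inj); apply/subset_leq_card/subsetP.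
move=> _ /imsetP[j + ->]; rewrite inE => /existsP[a /andP[ab]].
apply: contraNT => jY; rewrite (coord_span ab) summxE; apply/eqP/big1 => t _.
rewrite mxE bE evE /=; have [_ _ jA] := normalizedP j.
by have := contra (GY t _ jA) jY; rewrite negbK => /eqP ->; rewrite !mulr0.
Qed.

End NormalizedPoints.

(* n stands for s - 1: the ambient projective space is P^n, S has n.+1 variables. *)
Theorem theorem2p1 (K : finFieldType) (n : nat) (A : nat -> {set K})
    (d_ : nat -> nat) (d k l r : nat)
    (P : 'I_#|pcartesian n A| -> 'rV[K]_n.+1)
    (h_ : 'I_#|pcartesian n A| -> dhomog n.+1 K d) :
  (1 <= n)%N ->
  (forall i, (1 <= i <= n)%N -> d_ i = #|A i|) ->
  (2 <= d_ 1)%N ->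
  (forall i, (1 <= i < n)%N -> (d_ i <= d_ i.+1)%N) ->
  (1 <= d)%N ->
  [set ppoint (P i) | i in 'I_#|pcartesian n A|] = pcartesian n A ->
  (forall i, (h_ i).@[P i 0] != 0) ->
  d = (\sum_(1 <= i < k.+1) (d_ i - 1) + l)%N ->
  (k <= n - 1)%N ->
  (1 <= l <= d_ k.+1 - 1)%N ->
  (1 <= r <= n - k)%N ->
  ghw r (rm_code P h_) =
    (if r < n - k
     then (\prod_(k + r + 1 <= i < n.+1) d_ i) *
          ((d_ (k + 1) - l + 1) * \prod_(k + 2 <= i < (k + r).+1) d_ i - 1)
     else (d_ (k + 1) - l + 1) * \prod_(k + 2 <= i < n.+1) d_ i - 1)%N.
Proof.
move=> n1 dA d2 dle d1 PX h0 dE kn lk rk.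
have dge2 i : (1 <= i <= n)%N -> (2 <= d_ i)%N.
  elim: i => // i IH h; case: i IH h => // i IH h.
  by apply: leq_trans (dle _ _); [apply: IH|]; lia.
have dnat a b : (1 <= a)%N -> (b <= n.+1)%N ->
    (\prod_(a <= i < b) d_ i = \prod_(a <= i < b) #|A i|)%N.
  move=> a1 bn; rewrite big_nat_cond [RHS]big_nat_cond; apply: eq_bigr => i h.
  by apply: dA; lia.
(* Both branches equal this difference: for r < n - k the last product factors out, for r = n - k it
   is empty. *)
pose v := ((#|A k.+1| - l + 1) * \prod_(k + 2 <= i < n.+1) #|A i|
            - \prod_(k + r + 1 <= i < n.+1) #|A i|)%N.
have dk : d_ k.+1 = #|A k.+1| by apply: dA; lia.
transitivity v; last first.
  rewrite [(k + 1)%N]addn1 dk !dnat //; [|lia..].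
  rewrite /v; case: ifP => rnk; last by rewrite [X in (_ - X)%N]big_geq //; lia.
  rewrite mulnBr muln1 [(k + r + 1)%N]addn1.
  by rewrite (@big_cat_nat _ _ _ (k + r).+1) /= ?mulnA 1?mulnC //; lia.
have sum_eq : (\sum_(1 <= i < k.+1) (d_ i - 1) = \sum_(1 <= i < k.+1) (#|A i| - 1))%N.
  rewrite big_nat_cond [RHS]big_nat_cond; apply: eq_bigr => i h.
  by rewrite dA //; lia.
have A2 i : (1 <= i <= n)%N -> (2 <= #|A i|)%N by move=> h; rewrite -dA // dge2.
have lA : (0 < l < #|A k.+1|)%N by rewrite -dk; lia.
have wE : wt (side_lengths n A) d r = v.
  have := @wt_iota (fun i => #|A i|) 1 n k l r; rewrite !add1n -sum_eq -dE => ->.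
  - have -> : (k.+1 + 1 = k + 2)%N by lia.
    by have -> : (k.+1 + r = k + r + 1)%N by lia.
  - lia.
  - lia.
  - lia.
  - by move=> i h; have := A2 i; lia.
have nths i : (i < n)%N -> nth 0%N (side_lengths n A) i = d_ i.+1.
  by move=> li; rewrite (nth_map 0%N) ?size_iota // nth_iota // add1n dA.
have szs : size (side_lengths n A) = n by rewrite size_map size_iota.
have srt : sorted leq (side_lengths n A).
  apply/(sortedP 0%N) => i; rewrite szs => li.
  by rewrite !nths //; [apply: dle|]; lia.
have s1 : all (leq 1) (side_lengths n A).
  apply/(all_nthP 0%N) => i; rewrite szs => li; rewrite nths //.
  by have := dge2 i.+1; lia.
have r0 : (0 < r)%N by lia.
have krn : (k + r <= n)%N by lia.
have [G [Y [Gd GY Gsep cY]]] := low_weight_polys A2 r0 krn lA.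
rewrite -sum_eq -dE in Gd.
have [D0 [D0C dD0 cD0]] := ghw_upper PX h0 Gd GY Gsep.
apply/eqP; rewrite eqn_leq; apply/andP; split.
  by rewrite -/v in cY; rewrite -cY; apply: leq_trans cD0; apply: ghw_le.
(* [D0] also shows that r is at most the dimension of the code, so the minimum is attained. *)
have [|D [DC dD <-]] := @ghw_attained _ _ r (rm_code P h_).
  by rewrite -dD0; apply: dimvS.
rewrite -wE; exact: (ghw_lower PX h0 d1 r0 srt s1 DC dD).
Qed.
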